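(* For every $\epsilon > 0$ there exists $N = N(\epsilon)$ such that for every integer $q \ge N$ the following holds: if $G$ is a simple graph that is properly edge-colored with at least $2(1+\epsilon)q$ colors such that each color appears on at least $q$ edges, then $G$ contains a rainbow matching using $q$ colors (i.e., a rainbow matching of size $q$).
   Context: A proper edge-coloring is one in which no two edges sharing a vertex receive the same color. A matching is a set of pairwise vertex-disjoint edges; it is rainbow if its edges have pairwise distinct colors. *)

(* Defs.v *)
From mathcomp Require Import all_boot all_order all_algebra.
From mathcomp Require Import reals.

Set Implicit Arguments.
Unset Strict Implicit.
Unset Printing Implicit Defensive.

Record sgraph (V : finType) := SGraph {
  adj :> rel V;
  adj_sym : symmetric adj;
  adj_irrefl : irreflexive adj
}.

Section EdgeColorings.

Variables (V C : finType) (G : sgraph V).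

Definition edges : {set {set V}} := [set [set p.1; p.2] | p : V * V & G p.1 p.2].

(* An edge-coloring is a total function on vertex sets; only its values on
   [edges] matter. *)
Variable c : {set V} -> C.

Definition proper_edge_coloring : Prop :=
  forall e f : {set V}, e \in edges -> f \in edges ->
    e != f -> ~~ [disjoint e & f] -> c e != c f.

(* The colors actually used, which may be fewer than the elements of [C]. *)
Definition colors : {set C} := [set c e | e in edges].

Definition color_class (k : C) : {set {set V}} := [set e in edges | c e == k].

Definition matching (M : {set {set V}}) : Prop := M \subset edges /\ trivIset M.

Definition rainbow (M : {set {set V}}) : Prop := {in M &, injective c}.

Definition rainbow_matching (M : {set {set V}}) : Prop :=
  matching M /\ rainbow M.

End EdgeColorings.

(* Main.v *)
Require Import Defs.
From mathcomp Require Import all_boot all_order all_algebra.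
From mathcomp Require Import reals.
From mathcomp Require Import zify ring.

(* Let M be a maximum rainbow matching, of size m < q, and split the more than
   (1 + eps)q unused colors into a large part U and a small part F. Starting
   from O = V \ V(M), repeatedly take an edge xy of M such that x sends several
   edges of unused colors to O: as M can be rerouted through x, the vertex y may
   be left uncovered as well, so y joins O, x joins a set X, and xy is dropped
   from the vertex set C of the remaining edges of M. By maximality no edge of
   an available color lies inside O.
   First only colors of U are used, adding many vertices at each of a bounded
   number of rounds, so that rerouting needs few colors. When it stops, most
   colors of U are nearly perfect matchings on C, so U has more than |C|/2
   edges at most vertices of C; let A be the set of those vertices of C that,
   like their partners in M, are such. Any two vertices of A are then joined by a short alternating path
   with distinct colors of U.
   Then the colors of F are used, two fresh ones per step, to absorb the few
   vertices of C outside A. In the end a count shows that some colors of F send at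
   least two edges from O to A, and two such edges together with an alternating
   path in A enlarge the matching. *)

(** * Properly colored graphs and operations on rainbow matchings *)

Section ColoredGraph.

Set Implicit Arguments.
Unset Strict Implicit.
Unset Printing Implicit Defensive.

Variables (V K : finType) (G : sgraph V) (c : {set V} -> K).
Hypothesis c_proper : proper_edge_coloring G c.

Definition color_adj (k : K) (u v : V) : bool := G u v && (c [set u; v] == k).

Lemma cadj_sym k u v : color_adj k u v = color_adj k v u.
Proof. by rewrite /color_adj adj_sym setUC. Qed.

Lemma cadj_neq k u v : color_adj k u v -> u != v.
Proof. by case/andP=> Guv _; apply: contraTneq Guv => ->; rewrite adj_irrefl. Qed.

Lemma mem_edges u v : G u v -> [set u; v] \in edges G.
Proof. by move=> Guv; apply/imsetP; exists (u, v); rewrite ?inE. Qed.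

Lemma edgesP e : e \in edges G -> exists u v, [/\ G u v, u != v & e = [set u; v]].
Proof.
case/imsetP=> -[u v]; rewrite inE /= => Guv ->; exists u, v; split=> //.
by apply: contraTneq Guv => ->; rewrite adj_irrefl.
Qed.

Lemma set2_inj (u v w : V) : [set u; v] = [set u; w] -> v = w.
Proof.
move=> e; have := set22 u v; rewrite e !inE => /orP[/eqP vu|/eqP //].
by have := set22 u w; rewrite -e vu !inE => /orP[] /eqP.
Qed.

Lemma cadj_color_inj k u v w : color_adj k u v -> color_adj k u w -> v = w.
Proof.
case/andP=> Guv /eqP cuv /andP[Guw /eqP cuw]; apply/eqP/negPn/negP => vw.
have : c [set u; v] != c [set u; w].
  apply: c_proper; rewrite ?mem_edges //.
    by apply: contra vw => /eqP/set2_inj ->.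
  by apply/pred0Pn; exists u; rewrite /= !inE eqxx.
by rewrite cuv cuw eqxx.
Qed.

Lemma cadj_fun k k' u v : color_adj k u v -> color_adj k' u v -> k = k'.
Proof. by case/andP=> _ /eqP <- /andP[_ /eqP <-]. Qed.

Local Notation rm := (rainbow_matching G c).

Lemma rm_sub (N N' : {set {set V}}) : N' \subset N -> rm N -> rm N'.
Proof.
move=> sN [[Ne /trivIsetP Nt] Nr]; split; first split.
- exact: subset_trans Ne.
- by apply/trivIsetP => A B AN BN; apply: Nt; apply: (subsetP sN).
- by move=> A B AN BN; apply: Nr; apply: (subsetP sN).
Qed.

Lemma rm_trivI (N : {set {set V}}) : rm N -> trivIset N. Proof. by case=> -[]. Qed.

Lemma mem_cover (N : {set {set V}}) e x : e \in N -> x \in e -> x \in cover N.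
Proof. by move=> eN xe; apply/bigcupP; exists e. Qed.

Lemma coverP (N : {set {set V}}) x :
  reflect (exists2 e, e \in N & x \in e) (x \in cover N).
Proof. exact: bigcupP. Qed.

Lemma trivI_eq (N : {set {set V}}) e f x :
  trivIset N -> e \in N -> f \in N -> x \in e -> x \in f -> e = f.
Proof.
move=> /trivIsetP tN eN fN xe xf; apply/eqP/negPn/negP => ef.
by have /pred0P/(_ x) := tN _ _ eN fN ef; rewrite /= xe xf.
Qed.

Lemma rm_add (N : {set {set V}}) k u v :
  rm N -> color_adj k u v -> u \notin cover N -> v \notin cover N ->
  k \notin c @: N ->
  rm ([set u; v] |: N) /\ #|[set u; v] |: N| = #|N|.+1.
Proof.
move=> Nrm /andP[Guv /eqP ck] uN vN kN.
have eN : [set u; v] \notin N by apply: contra uN => /mem_cover -> //; rewrite set21.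
split; last by rewrite cardsU1 eN.
have dis B : B \in N -> [disjoint [set u; v] & B].
  move=> BN; apply/pred0P => x /=; rewrite !inE; apply/negP => /andP[/orP[]/eqP-> xB].
    by rewrite (mem_cover BN xB) in uN.
  by rewrite (mem_cover BN xB) in vN.
have [[Ne /trivIsetP Nt] Nr] := Nrm; split; first split.
- by rewrite subUset sub1set mem_edges.
- apply/trivIsetP => A B; rewrite !inE => /orP[/eqP->|AN] /orP[/eqP->|BN] AB.
  + by rewrite eqxx in AB.
  + exact: dis.
  + by rewrite disjoint_sym dis.
  + exact: Nt.
- move=> A B; rewrite !inE => /orP[/eqP->|AN] /orP[/eqP->|BN] //.
  + by move=> cB; case/negP: kN; rewrite -ck cB imset_f.
  + by move=> cA; case/negP: kN; rewrite -ck -cA imset_f.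
  + exact: Nr.
Qed.

Lemma sub_cover (N N' : {set {set V}}) : N' \subset N -> cover N' \subset cover N.
Proof. by move=> /subsetP s; apply/subsetP => x /coverP[e /s eN]; apply: mem_cover. Qed.

Lemma cover_setD1 (N : {set {set V}}) e x :
  trivIset N -> e \in N -> x \in e -> x \notin cover (N :\ e).
Proof.
move=> tN eN xe; apply/negP => /coverP[f]; rewrite !inE => /andP[fe fN] xf.
by rewrite (trivI_eq tN fN eN xf xe) eqxx in fe.
Qed.

End ColoredGraph.

(** * Double counting the edges of a color *)

Section Counting.

Set Implicit Arguments.
Unset Strict Implicit.
Unset Printing Implicit Defensive.

Variables (V K : finType) (G : sgraph V) (c : {set V} -> K).
Hypothesis c_proper : proper_edge_coloring G c.

Local Notation cadj := (color_adj G c).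

(** Pairs are ordered, so an edge with both ends in [A] and in [B] is counted twice. *)
Definition arcs (k : K) (A B : {set V}) : {set V * V} :=
  [set p | [&& p.1 \in A, p.2 \in B & cadj k p.1 p.2]].

Lemma arcsC k A B : #|arcs k A B| = #|arcs k B A|.
Proof.
have swapK : injective (fun p : V * V => (p.2, p.1)) by case=> a b [a' b'] [-> ->].
rewrite -(card_imset _ swapK); apply: eq_card => -[u v].
rewrite !inE /=; apply/imsetP/idP => [[[a b]]|].
  by rewrite inE /= => /and3P[aA bB ab] [-> ->]; rewrite aA bB cadj_sym ab.
case/and3P=> uB vA uv; exists (v, u) => //.
by rewrite inE /= vA uB cadj_sym uv.
Qed.

Lemma arcs_le k A B : #|arcs k A B| <= #|A|.
Proof.
rewrite -(@card_in_imset _ _ (fun p : V * V => p.1) (mem (arcs k A B))).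
  by apply/subset_leq_card/subsetP => u /imsetP[p]; rewrite inE => /and3P[pA _ _] ->.
move=> [a b] [a' b']; rewrite !inE /= => /and3P[_ _ e] /and3P[_ _ e'] eqa.
by rewrite -eqa in e' *; rewrite (cadj_color_inj c_proper e e').
Qed.

Lemma arcs_sum k A B : #|arcs k A B| = \sum_(v in A) #|[set u in B | cadj k v u]|.
Proof.
transitivity (\sum_(v in A) \sum_(u in B | cadj k v u) 1); last first.
  by apply: eq_bigr => v _; rewrite sum1_card; apply: eq_card => u; rewrite !inE.
by rewrite pair_big_dep /= sum1_card; apply: eq_card => -[u v]; rewrite !inE.
Qed.

(** Incidences are counted in two ways: every edge has two ends, and each incidence of a vertex with
    an edge of color [k] yields an arc. *)
Lemma class_arcs k : 2 * #|color_class G c k| <= #|arcs k setT setT|.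
Proof.
rewrite arcs_sum.
have -> : 2 * #|color_class G c k| = \sum_(e in color_class G c k) #|e|.
  rewrite mulnC -sum_nat_const; apply: eq_bigr => e.
  rewrite inE => /andP[/edgesP[u [v [_ uv ->]]] _].
  by rewrite cards2 uv.
have -> : \sum_(e in color_class G c k) #|e| =
          \sum_(v in [set: V]) #|[set e in color_class G c k | v \in e]|.
  rewrite (eq_bigr (fun e : {set V} => \sum_(v in e) 1)); last by move=> e _; rewrite sum1_card.
  rewrite (exchange_big_dep (mem [set: V])) /=; last by move=> *; rewrite inE.
  by apply: eq_bigr => v _; rewrite sum1dep_card.
apply: leq_sum => v _.
pose f u := [set v; u].
have /subset_leq_card : [set e in color_class G c k | v \in e] \subset
    f @: [set u in setT | cadj k v u].
  apply/subsetP => e; rewrite !inE => /andP[/andP[/edgesP[u [w [Guw _ ->]]] cuw]].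
  rewrite !inE => /orP[]/eqP vE; apply/imsetP.
    by exists w; rewrite /f vE // !inE /color_adj Guw cuw.
  by exists u; rewrite /f vE 1?setUC // !inE cadj_sym /color_adj Guw cuw.
by move/leq_trans; apply; apply: leq_imset_card.
Qed.

Section Partition.

Variables (k : K) (X O C : {set V}).
Hypothesis XOC : forall v, [|| v \in X, v \in O | v \in C].
Hypothesis O_indep : forall u v, u \in O -> v \in O -> ~~ cadj k u v.

Let arcs_XT : #|arcs k X setT| <= #|X|. Proof. exact: arcs_le. Qed.

(** As [O] is independent in color [k], an arc meets [X], or starts in [C], or goes from [O] to [C].
    A color has at most one arc out of each vertex, and at most one into it. *)
Lemma class_le_arcs_out :
  2 * #|color_class G c k| <= 2 * #|X| + #|C| + #|arcs k O C|.
Proof.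
apply: (leq_trans (class_arcs k)).
have /subset_leq_card/leq_trans : arcs k setT setT \subset
    arcs k X setT :|: arcs k setT X :|: arcs k C setT :|: arcs k O C.
  apply/subsetP => -[u v]; rewrite !inE /= => uv; rewrite uv !andbT.
  have := XOC u; have := XOC v; case: (u \in X) => //=; case: (v \in X) => //=.
  case: (u \in C) => //=; rewrite orbF => vOC uO; rewrite uO.
  by case/orP: vOC => // vO; move/negP: (O_indep uO vO).
apply; apply: leq_trans (leq_card_setU _ _) _; rewrite leq_add2r.
apply: leq_trans (leq_card_setU _ _) _; rewrite leq_add ?arcs_le //.
apply: leq_trans (leq_card_setU _ _) _.
by rewrite [#|arcs k setT X|]arcsC mul2n -addnn leq_add.
Qed.

(** The same case split, with arcs between [C] and [O] taken in both directions and those inside [C]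
    kept apart. It measures how far the color is from a perfect matching on [C]. *)
Lemma class_le_arcs_in :
  2 * #|color_class G c k| <= 2 * #|X| + 2 * #|arcs k C O| + #|arcs k C C|.
Proof.
apply: (leq_trans (class_arcs k)).
have /subset_leq_card/leq_trans : arcs k setT setT \subset
    arcs k X setT :|: arcs k setT X :|: (arcs k C O :|: arcs k O C) :|: arcs k C C.
  apply/subsetP => -[u v]; rewrite !inE /= => uv; rewrite uv !andbT.
  have := XOC u; have := XOC v; case: (u \in X) => //=; case: (v \in X) => //=.
  case: (boolP (u \in C)) => [uC|_] /=;
    case: (boolP (v \in C)) => [vC|_] //=;
    rewrite ?orbF ?orbT //.
    by move=> ->.
  by move=> _ ->.
  by move=> vO uO; move/negP: (O_indep uO vO).
apply; apply: leq_trans (leq_card_setU _ _) _; rewrite leq_add2r.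
apply: leq_trans (leq_card_setU _ _) _; apply: leq_add.
  apply: leq_trans (leq_card_setU _ _) _.
  by rewrite [#|arcs k setT X|]arcsC mul2n -addnn leq_add.
by apply: leq_trans (leq_card_setU _ _) _; rewrite [#|arcs k O C|]arcsC mul2n -addnn.
Qed.

End Partition.

(** By properness its size is also the number of colors of [Q] on edges from [v] to [A]. *)
Definition nbhd (Q : {set K}) (A : {set V}) (v : V) : {set V} :=
  [set u in A | G v u && (c [set v; u] \in Q)].

Lemma nbhd_color_inj (Q : {set K}) (A : {set V}) v :
  {in nbhd Q A v &, injective (fun u => c [set v; u])}.
Proof.
move=> u w; rewrite !inE => /and3P[_ vu _] /and3P[_ vw _] e.
by apply: (@cadj_color_inj _ _ _ _ c_proper (c [set v; u]) v); rewrite /color_adj ?vu ?vw ?e eqxx.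
Qed.

Lemma nbhd_le (Q : {set K}) (A : {set V}) v : #|nbhd Q A v| <= #|Q|.
Proof.
rewrite -(card_in_imset (@nbhd_color_inj Q A v)).
apply/subset_leq_card/subsetP => k /imsetP[u]; rewrite inE => /and3P[_ _ uQ] -> //.
Qed.

Lemma nbhd_sum (Q : {set K}) (A : {set V}) v :
  #|nbhd Q A v| = \sum_(k in Q) #|[set u in A | cadj k v u]|.
Proof.
rewrite -sum1_card (partition_big (fun u => c [set v; u]) (mem Q)) /=; last first.
  by move=> u; rewrite inE => /and3P[].
apply: eq_bigr => k kQ; rewrite sum1_card; apply: eq_card => u; rewrite !inE /color_adj.
rewrite -topredE /= !inE -!andbA.
by case: eqP => [->|]; rewrite ?kQ ?andbF ?andbT.
Qed.

Lemma sum_arcs (Q : {set K}) (A B : {set V}) :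
  \sum_(k in Q) #|arcs k A B| = \sum_(v in A) #|nbhd Q B v|.
Proof.
under eq_bigr do rewrite arcs_sum.
by rewrite exchange_big; apply: eq_bigr => v _; rewrite nbhd_sum.
Qed.

End Counting.

(** * Rerouting a maximum rainbow matching *)

Section Switching.

Set Implicit Arguments.
Unset Strict Implicit.
Unset Printing Implicit Defensive.

Variables (V K : finType) (G : sgraph V) (c : {set V} -> K).
Hypothesis c_proper : proper_edge_coloring G c.

Local Notation cadj := (color_adj G c).
Local Notation rm := (rainbow_matching G c).

Variable M : {set {set V}}.
Hypothesis Mrm : rm M.
Hypothesis Mmax : forall N, rm N -> #|N| <= #|M|.

(** The default makes this the identity outside [cover M]. *)
Definition partner (x : V) : V :=
  odflt x [pick y | (y != x) && ([set x; y] \in M)].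

Local Notation ed x := [set x; partner x].

Lemma partnerP x : x \in cover M -> partner x != x /\ ed x \in M.
Proof.
case/coverP=> e eM xe; rewrite /partner; case: pickP => [y /andP[]//|none].
have [[/subsetP Me _] _] := Mrm; have [u [v [_ uv eE]]] := edgesP (Me _ eM).
move: xe; rewrite eE !inE => /orP[]/eqP xE.
  by have := none v; rewrite xE -eE eM eq_sym uv.
by have := none u; rewrite xE setUC -eE eM uv.
Qed.

Lemma partner_cover x : x \in cover M -> partner x \in cover M.
Proof. by move=> /partnerP[_ eM]; apply: (mem_cover eM); rewrite set22. Qed.

Lemma edge_eq x y : x \in cover M -> y \in cover M -> y \in ed x -> ed y = ed x.
Proof.
move=> /partnerP[_ xM] /partnerP[_ yM] yx.
by apply: (trivI_eq (rm_trivI Mrm) yM xM _ yx); rewrite set21.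
Qed.

Lemma partnerK x : x \in cover M -> partner (partner x) = x.
Proof.
move=> xM; have px := partner_cover xM; apply: (@set2_inj _ (partner x)).
by rewrite (edge_eq xM px) ?set22 // setUC.
Qed.

Lemma edge_partner x : x \in cover M -> ed (partner x) = ed x.
Proof. by move=> xM; rewrite partnerK // setUC. Qed.

Lemma partner_inj : {in cover M &, injective partner}.
Proof. by move=> x y xM yM e; rewrite -(partnerK xM) e partnerK. Qed.

(* M can be rerouted, without using the colors of Q and keeping its edges inside
   C, so as to leave both o1 and o2 uncovered. *)
Definition free (Q : {set K}) (C : {set V}) (o1 o2 : V) : Prop :=
  exists N, [/\ rm N, #|N| = #|M|, {in C, forall v, ed v \in N},
    o1 \notin cover N /\ o2 \notin cover N & {in Q, forall k, k \notin c @: N}].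

Lemma freeC (Q : {set K}) (C : {set V}) o1 o2 : free Q C o1 o2 -> free Q C o2 o1.
Proof. by case=> N [? ? ? [? ?] ?]; exists N; split. Qed.

Lemma free_mono (Q Q' : {set K}) (C C' : {set V}) o1 o2 :
  Q' \subset Q -> C' \subset C -> free Q C o1 o2 -> free Q' C' o1 o2.
Proof.
move=> /subsetP sQ /subsetP sC [N [? ? CN ? QN]]; exists N; split=> //.
  by move=> v /sC/CN.
by move=> k /sQ/QN.
Qed.

(** The elementary switch: in the rerouted matching the edge at [x] is replaced by the edge [xp].
    This uncovers [partner x], covers [p], leaves [o] untouched and spends the color [k]. *)
Lemma free_swap (Q : {set K}) (C : {set V}) k x p o :
  free Q C p o -> p != o -> x \in C -> x \in cover M ->
  cadj k x p -> k \in Q ->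
  free (Q :\ k) (C :\ x :\ partner x) (partner x) o.
Proof.
case=> N [Nrm Ncard CN [pN oN] QN] po xC xM xpk kQ.
have ck : c [set x; p] = k by case/andP: xpk => _ /eqP.
have xN := CN _ xC; have tN := rm_trivI Nrm.
have xcov : x \in cover N by apply: (mem_cover xN); rewrite set21.
have xp : x != p by apply: contraNneq pN => <-.
have xo : x != o by apply: contraNneq oN => <-.
set N0 := N :\ ed x; have N0N : N0 \subset N by apply: subD1set.
have noto y : y \notin cover N -> y \notin cover N0.
  by apply: contra; apply: (subsetP (sub_cover N0N)).
have colN k' : k' \in Q -> k' \notin c @: N0.
  by move=> /QN; apply: contra; apply: (subsetP (imsetS _ N0N)).
have [x_N0 px_N0] : x \notin cover N0 /\ partner x \notin cover N0.
  by split; apply: (cover_setD1 tN xN); rewrite !inE eqxx ?orbT.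
have [N'rm N'card] : rm ([set x; p] |: N0) /\ #|[set x; p] |: N0| = #|N0|.+1.
  by apply: (rm_add (rm_sub N0N Nrm) xpk x_N0 (noto _ pN) (colN _ kQ)).
have cov y : y \in cover ([set x; p] |: N0) -> [|| y == x, y == p | y \in cover N0].
  case/coverP=> e; rewrite in_setU1 => /orP[/eqP->|eN0 /(mem_cover eN0) ->].
    by rewrite !inE orbA => ->.
  by rewrite !orbT.
exists ([set x; p] |: N0); split=> //.
- by rewrite N'card -Ncard (cardsD1 (ed x) N) xN.
- move=> v; rewrite !inE => /and3P[vpx vx vC]; rewrite CN // andbT.
  apply/orP; right; apply: contra vpx => /eqP e.
  by have := set21 v (partner v); rewrite e !inE (negbTE vx).
- have [pxx _] := partnerP xM; split; apply/negP => /cov.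
    rewrite (negbTE pxx) (negbTE px_N0) orbF => /eqP pxp.
    by rewrite -pxp (mem_cover xN) ?set22 in pN.
  by rewrite eq_sym (negbTE xo) eq_sym (negbTE po) (negbTE (noto _ oN)).
- move=> k'; rewrite !inE => /andP[k'k k'Q].
  by rewrite imsetU1 in_setU1 ck (negbTE k'k) colN.
Qed.

(** Such an edge could be added to the rerouted matching, against the maximality of [M]. *)
Lemma free_nonadj (Q : {set K}) (C : {set V}) o1 o2 k :
  free Q C o1 o2 -> k \in Q -> ~~ cadj k o1 o2.
Proof.
case=> N [Nrm Ncard _ [o1N o2N] QN] kQ; apply/negP => oo.
have [_ N'] := rm_add Nrm oo o1N o2N (QN _ kQ).
have [N'rm _] := rm_add Nrm oo o1N o2N (QN _ kQ).
by have := Mmax N'rm; rewrite N' Ncard ltnn.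
Qed.

(** Switching along [xo] leaves [partner x] and [p] both uncovered, with [k'] still available. *)
Lemma free_no_augment (Q : {set K}) (C : {set V}) x o p k k' :
  free Q C o p -> o != p -> x \in C -> x \in cover M ->
  k \in Q -> k' \in Q -> k != k' -> cadj k x o -> ~~ cadj k' (partner x) p.
Proof.
move=> fop op xC xM kQ k'Q kk' xo.
have := free_swap fop op xC xM xo kQ; move/free_nonadj; apply.
by rewrite !inE eq_sym kk'.
Qed.

Lemma freeable_neq (Q : {set K}) (C : {set V}) o p v :
  free Q C o p -> v \in C -> (v != o) && (v != p).
Proof.
case=> N [_ _ CN [oN pN] _] /CN vN; have vcov : v \in cover N by rewrite (mem_cover vN) ?set21.
by rewrite (contraNneq _ oN) ?(contraNneq _ pN) // => <-.
Qed.

(** Edges at [x] have distinct colors, so [Z] excludes at most [#|Z|] neighbours and [o] at most one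
    more. *)
Lemma nbhd_pick (Q : {set K}) (A : {set V}) x (Z : {set K}) (o : V) :
  #|Z|.+1 < #|nbhd G c Q A x| ->
  exists u k, [/\ u \in A, u != o, k \in Q, k \notin Z & cadj k x u].
Proof.
move=> big; pose W := [set u in nbhd G c Q A x | c [set x; u] \in Z].
have WZ : #|W| <= #|Z|.
  rewrite -(@card_in_imset _ _ (fun u => c [set x; u]) (mem W)); last first.
    by move=> u w; rewrite !(inE, in_set) => /andP[uN _] /andP[wN _];
      apply: (nbhd_color_inj c_proper (Q := Q) (A := A)); rewrite inE.
  by apply/subset_leq_card/subsetP => k /imsetP[u]; rewrite inE => /andP[_ uZ] ->.
have : 0 < #|nbhd G c Q A x :\: (o |: W)|.
  have := cardsID (o |: W) (nbhd G c Q A x).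
  have := subset_leq_card (subsetIr (nbhd G c Q A x) (o |: W)).
  rewrite cardsU1; lia.
case/card_gt0P=> u; rewrite !inE negb_or => /andP[/andP[uo]].
rewrite !negb_and => uW /and3P[uA Gu uQ]; exists u, (c [set x; u]); split=> //.
  by move: uW; rewrite uA Gu uQ.
by rewrite /color_adj Gu eqxx.
Qed.

(* A path with a single intermediate edge of M could be forced to repeat a color
   (as in a Cayley coloring of an elementary abelian 2-group), hence two. *)
Lemma connect (Q : {set K}) (A : {set V}) q r u v :
  A \subset cover M -> {in A, forall x, partner x \in A} -> #|A| <= 2 * q -> 7 <= r ->
  {in A, forall w, q + r <= #|nbhd G c Q A w|} -> u \in A -> v \in A ->
  exists a b k1 k2 k3, [/\ a \in A /\ b \in A,
    [/\ a \notin ed u, a \notin ed v, b \notin ed u, b \notin ed v & b \notin ed a],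
    [/\ k1 \in Q, k2 \in Q & k3 \in Q],
    [/\ k1 != k2, k1 != k3 & k2 != k3] &
    [/\ cadj k1 u a, cadj k2 (partner a) b & cadj k3 (partner b) v]].
Proof.
move=> /subsetP AM Apt Aq r7 Adeg uA vA.
(* The intermediate edges must avoid those at [u] and [v], which costs each neighborhood at most
   four vertices. *)
pose E := ed u :|: ed v; pose Nb w := nbhd G c Q A w :\: E.
have E4 : #|E| <= 4.
  by apply: leq_trans (leq_card_setU _ _) _; rewrite !cards2; case: eqP; case: eqP.
have Nb_big w : w \in A -> q + r <= #|Nb w| + 4.
  move=> /Adeg; have := cardsID E (nbhd G c Q A w).
  have := subset_leq_card (subsetIr (nbhd G c Q A w) E); rewrite -/(Nb w); lia.
have NbA w x : x \in Nb w -> x \in A by rewrite !inE => /andP[_ /andP[]].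
have Eclosed x : x \in A -> x \in E -> partner x \in E.
  move=> xA; rewrite /E (in_setU x (ed u) (ed v)) (in_setU _ (ed u) (ed v)).
  suff clos w : w \in A -> x \in ed w -> partner x \in ed w.
    by case/orP; [move/(clos _ uA)|move/(clos _ vA)] => ->; rewrite ?orbT.
  by move=> wA xw; rewrite -(edge_eq (AM _ wA) (AM _ xA) xw) set22.
(* The candidates for [b]: vertices whose partner is adjacent to [v]. *)
pose S := partner @: Nb v.
have SA x : x \in S -> [/\ x \in A, x \notin E & partner x \in Nb v].
  case/imsetP=> y yN ->; have yA := NbA _ _ yN; split; first exact: Apt.
    apply: contraTN yN => /(Eclosed _ (Apt _ yA)); rewrite partnerK ?AM // => yE.
    by rewrite inE yE.
  by rewrite partnerK ?AM.
have S_big : q + r <= #|S| + 4.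
  rewrite card_in_imset; first exact: Nb_big.
  by move=> x y /NbA/AM xM /NbA/AM yM; apply: partner_inj.
(* With [x] as the choice of [b], the three sets collect the color clashes: [Conf] those of the
   second and third edges, [W1] of the first and second, [W2] of the first and third. Only [Conf a]
   may be large for a single [a]. *)
pose Conf a := [set x in A | cadj (c [set partner x; v]) (partner a) x].
pose W1 a := [set x | cadj (c [set u; a]) (partner a) x].
pose W2 a := [set x in A | cadj (c [set u; a]) v (partner x)].
pose T a := (Nb (partner a) :&: S) :\: (a |: W1 a :|: W2 a).
have W1_le a : #|W1 a| <= 1.
  by apply/card_le1_eqP => x y; rewrite !inE => hx hy; apply: (cadj_color_inj c_proper hy hx).
have W2_le a : #|W2 a| <= 1.
  apply/card_le1_eqP => x y; rewrite !inE => /andP[xA hx] /andP[yA hy].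
  by apply: (partner_inj (AM _ yA) (AM _ xA)); apply: (cadj_color_inj c_proper hy hx).
(* Two subsets of [A] of size at least [q + r - 4] share at least [2 * r - 8], hence six, vertices;
   [a], [W1 a] and [W2 a] remove at most three. *)
have T_big a : a \in Nb u -> 2 <= #|T a|.
  move=> /NbA/Apt/Nb_big bbig.
  have := cardsID (a |: W1 a :|: W2 a) (Nb (partner a) :&: S); rewrite -/(T a).
  have := subset_leq_card (subsetIr (Nb (partner a) :&: S) (a |: W1 a :|: W2 a)).
  have := (leq_card_setU (a |: W1 a) (W2 a)).1; have := W1_le a; have := W2_le a.
  have := cardsU1 a (W1 a); have := leq_b1 (a \notin W1 a).
  have /subset_leq_card : Nb (partner a) :|: S \subset A.
    by apply/subsetP => x; rewrite in_setU => /orP[/NbA|/SA[]].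
  rewrite cardsU; have := subset_leq_card (subsetIl (Nb (partner a)) S); lia.
(* Either some candidate escapes [Conf] and gives the path, or every [Conf a] has at least two
   elements. *)
have [/existsP[a /andP[aN /subsetPn[b bT bC]]]|/existsPn none] :=
    boolP [exists a in Nb u, ~~ (T a \subset Conf a)].
  move: bT bC; rewrite in_setD !in_setU !in_setI in_set1 !negb_or.
  case/andP=> /andP[/andP[ba bW1] bW2] /andP[bN bS].
  have [bA bE pbN] := SA _ bS; have aA := NbA _ _ aN.
  move: aN bN pbN; rewrite !inE => /andP[aE /and3P[_ Gua aQ]].
  move=> /andP[_ /and3P[_ Gab bQ]] /andP[_ /and3P[_ Gvb pbQ]].
  rewrite bA /= => conf; move: bW1 bW2; rewrite !inE bA /color_adj Gab Gvb /= => w1 w2.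
  move: conf; rewrite /color_adj Gab /= (setUC [set partner b]) => conf.
  exists a, b, (c [set u; a]), (c [set partner a; b]), (c [set partner b; v]).
  move: aE bE; rewrite !inE !negb_or.
  move=> /andP[/andP[-> ->] /andP[-> ->]] /andP[/andP[-> ->] /andP[-> ->]].
  have bpa : b != partner a by apply: contraTneq Gab => ->; rewrite adj_irrefl.
  rewrite (setUC [set partner b]) (eq_sym (c [set u; a])) w1 (eq_sym (c [set u; a])) w2.
  by split; rewrite ?ba ?bpa ?Gua ?Gab ?(adj_sym G (partner b)) ?Gvb ?eqxx ?conf.
have Conf_big a : a \in Nb u -> 2 <= #|Conf a|.
  move=> aN; apply: leq_trans (T_big _ aN) (subset_leq_card _).
  by have := none a; rewrite aN /= negbK.
(* The sets [Conf a] are disjoint: [x] fixes the color of the edge from [partner x] to [v], and the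
   edge of that color at [x] fixes [partner a]. Hence twice [#|Nb u|] would be at most [2 * q],
   which is too small. *)
have : \sum_(a in Nb u) #|Conf a| <= #|A|.
  pose P := [set p : V * V | (p.1 \in Nb u) && (p.2 \in Conf p.1)].
  have -> : \sum_(a in Nb u) #|Conf a| = #|P|.
    transitivity (\sum_(a in Nb u) \sum_(x in Conf a) 1).
      by apply: eq_bigr => a _; rewrite sum1_card.
    by rewrite pair_big_dep /= sum1dep_card; apply: eq_card => -[a x]; rewrite !inE.
  rewrite -(@card_in_imset _ _ (fun p : V * V => p.2) (mem P)).
    apply/subset_leq_card/subsetP => x /imsetP[p]; rewrite in_set => /andP[_].
    by rewrite in_set => /andP[pA _] ->.
  move=> [a x] [a' x']; rewrite /= !(in_set (fun p : V * V => _)) /= => /andP[aN].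
  rewrite in_set => /andP[_ ax] /andP[aN']; rewrite in_set => /andP[_ ax'] xx'.
  rewrite -xx' cadj_sym in ax'; rewrite cadj_sym in ax; congr (_, _) => //.
  apply: (partner_inj (AM _ (NbA _ _ aN)) (AM _ (NbA _ _ aN'))).
  exact: (cadj_color_inj c_proper ax ax').
have : 2 * #|Nb u| <= \sum_(a in Nb u) #|Conf a|.
  by rewrite mulnC -sum_nat_const leq_sum.
have := Nb_big _ uA; lia.
Qed.

(** * Rounds of switching with the colors of [U] *)

Variables (q : nat) (U : {set K}).
Hypothesis Mq : #|M| < q.

(* B is the number of further colors of U that rerouting must be able to avoid. *)
Definition state (B : nat) (F : {set K}) (X O C : {set V}) : Prop :=
  [/\ C \subset cover M, {in C, forall v, partner v \in C},
    forall v, [|| v \in X, v \in O | v \in C],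
    2 * #|X| + #|C| <= 2 * #|M| &
    forall (Z : {set K}) o p, Z \subset U -> #|Z| <= B -> o \in O -> p \in O -> o != p ->
      free (F :|: Z) C o p].

Lemma state_le B B' F X O C : B' <= B -> state B F X O C -> state B' F X O C.
Proof.
move=> BB' [? ? ? ? fr]; split=> // Z o p ZU ZB'.
by apply: fr => //; apply: leq_trans BB'.
Qed.

Lemma card_cover : #|cover M| = 2 * #|M|.
Proof.
have [[/subsetP Me tM] _] := Mrm; move/eqP: (tM) => <-.
rewrite mulnC -sum_nat_const; apply: eq_bigr => e /Me/edgesP[u [v [_ uv ->]]].
by rewrite cards2 uv.
Qed.

Lemma state_init B F : {in F :|: U, forall k, k \notin c @: M} ->
  state B F set0 (~: cover M) (cover M).
Proof.
move=> FM; split=> //.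
- exact: partner_cover.
- by move=> v; rewrite !inE; case: (v \in cover M).
- by rewrite cards0 card_cover.
- move=> Z o p ZU _; rewrite !inE => oM pM _; exists M; split=> //.
    by move=> v /partnerP[].
  by move=> k; rewrite inE => /orP[kF|/(subsetP ZU) kU]; apply: FM; rewrite inE ?kF ?kU ?orbT.
Qed.

Lemma state_indep B F X O C k : 0 < B -> state B F X O C -> k \in F :|: U ->
  {in O &, forall u v, ~~ cadj k u v}.
Proof.
move=> B0 [_ _ _ _ fr] kFU u v uO vO; apply/negP => uv.
have [Z [ZU Z1 kZ]] : exists Z : {set K}, [/\ Z \subset U, #|Z| <= 1 & k \in F :|: Z].
  move: kFU; rewrite inE => /orP[kF|kU].
    by exists set0; rewrite sub0set cards0 inE kF.
  by exists [set k]; rewrite sub1set kU cards1 !inE eqxx orbT.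
have := fr _ _ _ ZU (leq_trans Z1 B0) uO vO (cadj_neq uv).
by move/free_nonadj => /(_ _ kZ)/negP.
Qed.

Lemma cardsU1_le (k : K) (Z : {set K}) : #|k |: Z| <= #|Z|.+1.
Proof. by rewrite cardsU1 -add1n leq_add2r leq_b1. Qed.

Definition heavy T (O C : {set V}) : {set V} := [set x in C | T < #|nbhd G c U O x|].

(** If both ends of an edge of [M] were heavy, they would send edges of distinct colors to distinct
    vertices of [O], and these would augment the matching. *)
Lemma heavy_partner B F X O C T : state B F X O C -> 2 <= B -> 2 <= T ->
  {in heavy T O C, forall x, partner x \notin heavy T O C}.
Proof.
case=> CM Cpt _ _ fr B2 T2 x; rewrite !inE => /andP[xC xT].
apply/negP => /andP[_ pT].
have [|o [k [oO _ kU _ xo]]] := @nbhd_pick U O x set0 x.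
  by rewrite cards0; apply: leq_trans xT; rewrite ltnW.
have [|p [k' [pO po k'U k'k pxp]]] := @nbhd_pick U O (partner x) [set k] o.
  by rewrite cards1; apply: leq_ltn_trans pT.
rewrite inE in k'k; rewrite eq_sym in po.
have fop : free (F :|: [set k; k']) C o p.
  apply: fr => //; first by rewrite subUset !sub1set kU.
  by rewrite cards2; apply: leq_trans B2; case: (k != k').
have kk' : k != k' by rewrite eq_sym.
have := free_no_augment (k := k) (k' := k') fop po xC (subsetP CM _ xC) _ _ kk' xo.
by rewrite !inE !eqxx !orbT pxp => /(_ isT isT).
Qed.

(** One round treats all heavy vertices at once. Freeing a pair takes at most one switch per newly
    freed vertex, so the round costs two colors of [U] however many vertices it moves. *)
Lemma state_heavy B F X O C T : state B.+2 F X O C -> B.+2 <= T -> [disjoint F & U] ->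
  exists X' O' C', state B F X' O' C' /\ #|C'| + 2 * #|heavy T O C| = #|C|.
Proof.
move=> st BT FU; have [CM Cpt XOC XC fr] := st.
set H := heavy T O C.
have T2 : 2 <= T by apply: leq_trans BT.
have Hp := heavy_partner st (isT : 2 <= B.+2) T2; rewrite -/H in Hp.
have HC : H \subset C by apply/subsetP => x; rewrite inE => /andP[].
have HM x : x \in H -> x \in cover M by move/(subsetP HC)/(subsetP CM).
pose P := partner @: H.
have PC : P \subset C by apply/subsetP => _ /imsetP[x /(subsetP HC) xC ->]; apply: Cpt.
have Pcard : #|P| = #|H|.
  by rewrite card_in_imset // => x y /HM xM /HM yM; apply: partner_inj.
have HP : [disjoint H & P].
  apply/pred0P => x /=; apply/negP => /andP[xH /imsetP[y yH xE]].
  by have := Hp _ yH; rewrite -xE xH.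
have Ccard : #|C :\: (H :|: P)| + 2 * #|H| = #|C|.
  have HPC : H :|: P \subset C by rewrite subUset HC.
  have := cardsID (H :|: P) C; have /setIidPr -> := HPC.
  rewrite cardsU; have /eqP -> : H :&: P == set0 by rewrite setI_eq0.
  by rewrite cards0; lia.
exists (X :|: H), (O :|: P), (C :\: (H :|: P)); split=> //.
have closed x : x \in C -> x \in H :|: P -> partner x \in H :|: P.
  move=> xC; rewrite !in_setU => /orP[xH|/imsetP[y yH ->]].
    by rewrite imset_f ?orbT.
  by rewrite partnerK ?HM // yH.
split.
- by apply: subset_trans CM; apply: subsetDl.
- move=> x; rewrite in_setD => /andP[xHP xC]; rewrite in_setD Cpt // andbT.
  apply: contra xHP => /(closed _ (Cpt _ xC)); rewrite partnerK //.
  exact: (subsetP CM).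
- by move=> v; rewrite in_setD !in_setU; have := XOC v;
    case: (v \in X); case: (v \in O); case: (v \in C); case: (v \in H); case: (v \in P).
- by have := (leq_card_setU X H).1; lia.
have new x (Z : {set K}) o : x \in H -> Z \subset U -> #|Z| <= B.+1 -> o \in O ->
    exists p k, [/\ p \in O, p != o, k \in U, k \notin F :|: Z & cadj k x p].
  rewrite inE => /andP[xC xT] ZU ZB oO.
  have [|p [k [pO po kU kZ xp]]] := @nbhd_pick U O x Z o.
    by apply: leq_ltn_trans xT; apply: leq_trans BT.
  exists p, k; split=> //; rewrite inE negb_or kZ andbT.
  by apply/negP => kF; have /pred0P/(_ k) := FU; rewrite /= kF kU.
have one x (Z : {set K}) o : x \in H -> Z \subset U -> #|Z| <= B.+1 -> o \in O ->
    free (F :|: Z) (C :\ x :\ partner x) (partner x) o.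
  move=> xH ZU ZB oO; have [p [k [pO po kU kZ xp]]] := new x Z o xH ZU ZB oO.
  have fpo : free (F :|: (k |: Z)) C p o.
    apply: fr => //; first by rewrite subUset sub1set kU.
    exact: leq_trans (cardsU1_le _ _) _.
  have := free_swap fpo po (subsetP HC _ xH) (HM _ xH) xp _.
  rewrite !inE eqxx orbT => /(_ isT); apply: free_mono => //.
  apply/subsetP => k' k'Z; rewrite in_setD1 setUCA in_setU k'Z orbT andbT.
  by apply: contraNneq kZ => <-.
have Csub x : x \in H -> C :\: (H :|: P) \subset C :\ x :\ partner x.
  move=> xH; apply/subsetP => v; rewrite !in_setD !in_setU !in_set1 negb_or.
  move=> /andP[/andP[vH vP] ->]; rewrite andbT; apply/andP; split.
    by apply: contraNneq vP => ->; apply: imset_f.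
  by apply: contraNneq vH => ->.
move=> Z o p ZU ZB; rewrite !in_setU => oOP pOP op.
case/orP: oOP op => [oO|/imsetP[x xH ->]]; case/orP: pOP => [pO|/imsetP[y yH ->]] op.
- apply: free_mono (subxx _) (subsetDl _ _) _; apply: fr => //.
  by apply: leq_trans ZB _; rewrite -addn2 leq_addr.
- apply: freeC; apply: free_mono (subxx _) (Csub _ yH) _.
  by apply: one => //; apply: leqW.
- apply: free_mono (subxx _) (Csub _ xH) _.
  by apply: one => //; apply: leqW.
(* Both vertices are new. With [k], the color of an edge from [x] to some [p0] in [O], held in
   reserve, [partner y] is freed together with [p0]; then [x] is switched onto [p0]. *)
have xy : x != y by apply: contraNneq op => ->.
have [oO|noO] := pickP [in O]; last first.
  move: xH; rewrite inE => /andP[_]; rewrite ltnNge => /negP[].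
  by rewrite [#|_|]eq_card0 // => u; rewrite inE (_ : (u \in O) = false) ?(noO u).
move=> oOO; have [p0 [k [p0O _ kU kZ xp]]] := new x Z oO xH ZU (leqW ZB) oOO.
have kZU : k |: Z \subset U by rewrite subUset sub1set kU.
have kZB : #|k |: Z| <= B.+1 by apply: leq_trans (cardsU1_le _ _) _.
have fy := freeC (one y _ p0 yH kZU kZB p0O).
have yx : y != x by rewrite eq_sym.
have xC' : x \in C :\ y :\ partner y.
  rewrite !inE xy (subsetP HC) // !andbT.
  by apply: contraTneq xH => ->; apply: Hp.
have p0y : p0 != partner y.
  have pyC : partner y \in C :\ x :\ partner x.
    rewrite !inE eq_sym op (Cpt _ (subsetP HC _ yH)) andbT andTb.
    by apply: contraTneq xH => <-; apply: Hp.
  by have /andP[_] := freeable_neq (one x Z p0 xH ZU (leqW ZB) p0O) pyC; rewrite eq_sym.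
have := free_swap fy p0y xC' (HM _ xH) xp _.
rewrite !inE eqxx orbT => /(_ isT); apply: free_mono.
  apply/subsetP => k' k'Z; rewrite in_setD1 setUCA in_setU k'Z orbT andbT.
  by apply: contraNneq kZ => <-.
apply/subsetP => v vC; have := subsetP (Csub _ xH) _ vC; have := subsetP (Csub _ yH) _ vC.
by rewrite !in_setD !in_set1 => /andP[-> /andP[-> ->]] /andP[-> /andP[-> _]].
Qed.

(** Each round with at least [h] heavy vertices removes at least [2 * h] vertices from [C], so fewer
    than [J] rounds are made, at two colors each. *)
Lemma few_heavy B F X O C T h J : state (B + 2 * J) F X O C -> B + 2 * J <= T ->
  [disjoint F & U] -> #|C| < 2 * h * J ->
  exists X' O' C', state B F X' O' C' /\ #|heavy T O' C'| < h.
Proof.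
elim: J X O C => [|J IH] X O C st BT FU; first by rewrite muln0.
case: (ltnP #|heavy T O C| h) => [few _|many CJ].
  by exists X, O, C; split=> //; apply: state_le st; rewrite leq_addr.
have e : B + 2 * J.+1 = (B + 2 * J).+2 by lia.
rewrite e in st BT; have [X' [O' [C' [st' C'C]]]] := state_heavy st BT FU.
by apply: IH st' _ FU _; lia.
Qed.

Hypothesis U_big : {in U, forall k, q <= #|color_class G c k|}.

Definition deficient g (C : {set V}) : {set V} :=
  [set v in C | #|nbhd G c U C v| + g < #|U|].

(** Summed over [U], what the colors miss inside [C] is at most twice the number of arcs from [C] to
    [O]. Heavy vertices send at most [#|U|] of these each, the others at most [T]. *)
Lemma deficient_le B F X O C T h g : 0 < B -> state B F X O C ->
  #|heavy T O C| <= h ->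
  #|deficient g C| * g.+1 <= 2 * (T * #|C| + h * #|U|).
Proof.
move=> B0 st Hh; have [CM Cpt XOC XC fr] := st.
(* This combines [class_le_arcs_in] with [2 * #|X| + #|C| <= 2 * #|M|] and [#|M| < q]. *)
have color_le k : k \in U -> #|C| <= 2 * #|arcs G c k C O| + #|arcs G c k C C|.
  move=> kU; have indep := state_indep B0 st (k := k) _.
  have := class_le_arcs_in c_proper XOC (indep _) (k := k).
  rewrite in_setU kU orbT => /(_ isT); have := U_big kU; lia.
have sum_le : #|U| * #|C| <=
    2 * (\sum_(v in C) #|nbhd G c U O v|) + \sum_(v in C) #|nbhd G c U C v|.
  rewrite -sum_nat_const -!sum_arcs big_distrr /= -big_split /=.
  exact: leq_sum.
have out_le : \sum_(v in C) #|nbhd G c U O v| <= T * #|C| + h * #|U|.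
  apply: (@leq_trans (\sum_(v in C) (T + (v \in heavy T O C) * #|U|))).
    apply: leq_sum => v vC; rewrite inE vC /=; case: (ltnP T) => [_|]; last by rewrite addn0.
    by rewrite mul1n; apply: leq_trans (nbhd_le c_proper _ _ _) (leq_addl _ _).
  rewrite big_split /= sum_nat_const mulnC leq_add2l -big_distrl /= leq_mul2r.
  apply/orP; right; apply: leq_trans Hh; rewrite -sum1_card big_mkcond /=.
  rewrite [X in _ <= X]big_mkcond /=; apply: leq_sum => v _.
  by case: (v \in C); case: (v \in heavy T O C).
have in_le : \sum_(v in C) #|nbhd G c U C v| +
    \sum_(v in C) (#|U| - #|nbhd G c U C v|) = #|U| * #|C|.
  rewrite -big_split mulnC -sum_nat_const /=; apply: eq_bigr => v _.
  by rewrite subnKC // nbhd_le.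
have : #|deficient g C| * g.+1 <= \sum_(v in C) (#|U| - #|nbhd G c U C v|).
  rewrite -sum_nat_const [X in X <= _]big_mkcond [X in _ <= X]big_mkcond /=.
  apply: leq_sum => v _; rewrite inE; case: (v \in C) => //=.
  by case: ltnP => // ?; lia.
move: sum_le out_le in_le.
move: (\sum_(v in C) _) (\sum_(v in C) _) (\sum_(v in C) _) => x y z; lia.
Qed.

(** * Absorbing vertices with the colors of [F], and the final augmentation *)

(** The switch at [x] is paid for with two colors of [F], so the reserve of three colors of [U]
    stays intact. *)
Lemma state_extend F X O C x : state 3 F X O C -> [disjoint F & U] ->
  x \in C -> 2 <= #|nbhd G c F O x| ->
  exists X' O' F', [/\ state 3 F' X' O' (C :\ x :\ partner x), F' \subset F &
    #|F| <= #|F'| + 2].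
Proof.
case=> CM Cpt XOC XC fr FU xC.
case/card_gt1P=> p [p' [pN p'N pp']].
have := nbhd_color_inj c_proper pN p'N.
move: pN p'N; rewrite !inE => /and3P[pO Gp pF] /and3P[p'O Gp' p'F] kk'.
set k := c [set x; p] in pF kk'; set k' := c [set x; p'] in p'F kk'.
have xM := subsetP CM _ xC; have [pxx _] := partnerP xM.
exists (x |: X), (partner x |: O), (F :\ k :\ k'); split; last first.
- rewrite (cardsD1 k F) pF (cardsD1 k' (F :\ k)) addnA addnC leq_add2l.
  by case: (k' \in _).
- by apply: subset_trans (subD1set _ _) (subD1set _ _).
have CxC : C :\ x :\ partner x \subset C by apply: subset_trans (subD1set _ _) (subD1set _ _).
split.
- exact: subset_trans CxC CM.
- move=> v; rewrite !inE => /and3P[vpx vx vC]; have vM := subsetP CM _ vC.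
  rewrite Cpt // andbT; apply/andP; split.
    by apply: contraNneq vx => /(partner_inj vM xM) ->.
  by apply: contraNneq vpx => <-; rewrite partnerK.
- by move=> v; rewrite !inE; have := XOC v; case: (v == x); case: (v == partner x);
    case: (v \in X); case: (v \in O); case: (v \in C).
- move: XC; rewrite (cardsD1 x C) (cardsD1 (partner x) (C :\ x)) !inE pxx Cpt // xC.
  by rewrite cardsU1; case: (x \notin X); clear; lia.
have sub Z : F :\ k :\ k' :|: Z \subset F :|: Z.
  by apply: setSU; apply: subset_trans (subD1set _ _) (subD1set _ _).
have notZ (Z : {set K}) l : Z \subset U -> l \in F -> l \notin Z.
  move=> ZU lF; apply/negP => /(subsetP ZU) lU.
  by have /pred0P/(_ l) := FU; rewrite /= lF lU.
have one (Z : {set K}) o : Z \subset U -> #|Z| <= 3 -> o \in O ->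
    free (F :\ k :\ k' :|: Z) (C :\ x :\ partner x) (partner x) o.
  move=> ZU ZB oO.
  (* Of the two neighbours [p] and [p'], at least one differs from [o]; this is why both colors are
     set aside. *)
  have [r [l [rO ro lF ll xr]]] : exists r l, [/\ r \in O, r != o, l \in F,
      (l == k) || (l == k') & cadj l x r].
    case: (eqVneq p o) => [po|po].
      exists p', k'; split; rewrite // ?eqxx ?orbT // /color_adj ?Gp' ?eqxx //.
      by rewrite -po; apply: contra_neq pp'.
    by exists p, k; split; rewrite // ?eqxx // /color_adj Gp eqxx.
  have := free_swap (fr _ _ _ ZU ZB rO oO ro) ro xC xM xr _.
  rewrite inE lF => /(_ isT); apply: free_mono => //.
  apply/subsetP => i; rewrite !inE => /orP[/and3P[ik' ik ->]|iZ].
    by rewrite andbT; case/orP: ll => /eqP ->.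
  rewrite iZ orbT andbT; apply: contraTneq iZ => ->; exact: notZ.
move=> Z o p1 ZU ZB; rewrite !in_setU1 => /orP[/eqP->|oO] /orP[/eqP->|pO1] op.
- by rewrite eqxx in op.
- exact: one.
- by apply: freeC; apply: one.
- exact: free_mono (sub Z) CxC (fr _ _ _ ZU ZB oO pO1 op).
Qed.

(** Each extension removes two vertices from [C] outside [A] and at most two colors from [F], so the
    excess of colors over such vertices never drops. *)
Lemma state_saturate (A : {set V}) F X O C : state 3 F X O C -> [disjoint F & U] ->
  A \subset C -> {in A, forall v, partner v \in A} ->
  exists X' O' C' F', [/\ state 3 F' X' O' C', F' \subset F, A \subset C',
    #|F| + #|C' :\: A| <= #|F'| + #|C :\: A| &
    {in C' :\: A, forall x, #|nbhd G c F' O' x| <= 1}].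
Proof.
have [n] := ubnP #|C :\: A|; elim: n F X O C => // n IH F X O C Cn st FU AC Apt.
case: (boolP [forall x in C :\: A, #|nbhd G c F O x| <= 1]) => [/forallP all1|].
  by exists X, O, C, F; split=> // x xCA; have := all1 x; rewrite xCA.
case/forallPn=> x; rewrite negb_imply -ltnNge => /andP[xCA x2].
move: (xCA); rewrite inE => /andP[xA xC].
have [CM Cpt _ _ _] := st; have xM := subsetP CM _ xC; have [pxx _] := partnerP xM.
have pxA : partner x \notin A by apply: contra xA => /Apt; rewrite partnerK.
have [X' [O' [F' [st' F'F cardF]]]] := state_extend st FU xC x2.
have CA : #|C :\ x :\ partner x :\: A| + 2 = #|C :\: A|.
  have -> : C :\ x :\ partner x :\: A = (C :\: A) :\ x :\ partner x.
    by apply/setP => v; rewrite !inE; case: (v \in A); rewrite ?andbF.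
  rewrite (cardsD1 x (C :\: A)) xCA (cardsD1 (partner x) (C :\: A :\ x)).
  by rewrite !inE pxx pxA (Cpt _ xC) addnA addnC.
have AC' : A \subset C :\ x :\ partner x.
  apply/subsetP => v vA; rewrite !inE (subsetP AC) // andbT.
  by apply/andP; split; [apply: contraNneq pxA|apply: contraNneq xA] => <-.
have FU' : [disjoint F' & U] by apply: disjointWl FU.
have [|X1 [O1 [C1 [F1 [st1 F1F AC1 cardF1 all1]]]]] := IH _ _ _ _ _ st' FU' AC' Apt.
  by move: Cn CA; clear; lia.
exists X1, O1, C1, F1; split=> //; first exact: subset_trans F'F.
by move: cardF1 cardF CA; clear; lia.
Qed.

(* Three colors are needed: two colors can each have two edges that together
   form an alternating 4-cycle. *)
Lemma disjoint_arcs (k1 k2 k3 : K) (O A : {set V}) :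
  k1 != k2 -> k1 != k3 -> k2 != k3 ->
  1 < #|arcs G c k1 O A| -> 1 < #|arcs G c k2 O A| -> 1 < #|arcs G c k3 O A| ->
  exists k k' o p g h, [/\ (k \in [:: k1; k2; k3]) /\ (k' \in [:: k1; k2; k3]), k != k',
    o != p, g != h & ((o, g) \in arcs G c k O A) /\ ((p, h) \in arcs G c k' O A)].
Proof.
move=> k12 k13 k23 /card_gt1P[[o1 g1] [[o2 g2] [a1 a2 a12]]] big2 big3.
have [adj1 adj2] : cadj k1 o1 g1 /\ cadj k1 o2 g2.
  by move: a1 a2; rewrite !inE => /and3P[_ _ ?] /and3P[_ _ ?].
have o12 : o1 != o2.
  apply: contra_neq a12 => oE; rewrite -oE in adj2 *.
  by rewrite (cadj_color_inj c_proper adj1 adj2).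
have g12 : g1 != g2.
  apply: contra_neq a12 => gE; rewrite cadj_sym in adj1; rewrite cadj_sym -gE in adj2.
  by rewrite -gE (cadj_color_inj c_proper adj1 adj2).
(* Only the crossing arcs [(o1, g2)] and [(o2, g1)] can meet both arcs of color [k1]; any other arc
   is disjoint from one of them. *)
have clash k : k \in [:: k2; k3] -> ~~ (arcs G c k O A \subset [set (o1, g2); (o2, g1)]) ->
  exists k k' o p g h, [/\ (k \in [:: k1; k2; k3]) /\ (k' \in [:: k1; k2; k3]), k != k',
    o != p, g != h & ((o, g) \in arcs G c k O A) /\ ((p, h) \in arcs G c k' O A)].
  move=> k23' /subsetPn[[p h] ph]; rewrite !inE !xpair_eqE negb_or => pq.
  have k1k : k1 != k by move: k23'; rewrite !inE => /orP[]/eqP->.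
  have kin : k \in [:: k1; k2; k3] by rewrite inE k23' orbT.
  have k1in : k1 \in [:: k1; k2; k3] by rewrite inE eqxx.
  case: (boolP ((o1 != p) && (g1 != h))) => [/andP[op gh]|n1].
    by exists k1, k, o1, p, g1, h.
  exists k1, k, o2, p, g2, h; suff /andP[op gh] : (o2 != p) && (g2 != h) by [].
  move: n1 pq; rewrite negb_and !negbK => /orP[]/eqP <-; rewrite !eqxx /=.
    by rewrite (eq_sym o2) o12 (eq_sym g2) => /andP[].
  by rewrite (eq_sym g2) g12 !andbT (eq_sym o2) => /andP[].
case: (boolP (arcs G c k2 O A \subset [set (o1, g2); (o2, g1)])) => [sub2|]; last first.
  by apply: clash; rewrite !inE eqxx.
case: (boolP (arcs G c k3 O A \subset [set (o1, g2); (o2, g1)])) => [sub3|]; last first.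
  by apply: clash; rewrite !inE eqxx orbT.
have two : #|[set (o1, g2); (o2, g1)]| = 2 by rewrite cards2 xpair_eqE (negbTE o12).
have eq2 k : arcs G c k O A \subset [set (o1, g2); (o2, g1)] -> 1 < #|arcs G c k O A| ->
    cadj k o1 g2.
  move=> sub big; have /eqP E : arcs G c k O A == [set (o1, g2); (o2, g1)].
    by rewrite eqEcard sub two.
  by have := set21 (o1, g2) (o2, g1); rewrite -E inE => /and3P[].
by have := cadj_fun (eq2 _ sub2 big2) (eq2 _ sub3 big3) => /eqP; rewrite (negbTE k23).
Qed.

(** Two disjoint arcs from [O] to [A] in different colors of [F], joined through [A] by the path of
    [connect], form an augmenting path. *)
Lemma augment_final (A : {set V}) F X O C r : state 3 F X O C -> [disjoint F & U] ->
  A \subset C -> {in A, forall v, partner v \in A} -> 7 <= r ->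
  {in A, forall w, q + r <= #|nbhd G c U A w|} ->
  {in F, forall k, q <= #|color_class G c k|} ->
  {in C :\: A, forall x, #|nbhd G c F O x| <= 1} ->
  #|C :\: A| + 2 < #|F| -> False.
Proof.
move=> st FU AC Apt r7 Adeg F_big light Fcard; have [CM Cpt XOC XC fr] := st.
have AM := subset_trans AC CM.
(* Each vertex of [C] outside [A] spoils at most one color of [F], so at least three colors have all
   their arcs between [O] and [C] ending in [A]. *)
pose S := [set k in F | #|arcs G c k (C :\: A) O| == 0].
have S3 : 2 < #|S|.
  have : #|F :\: S| <= #|C :\: A|.
    rewrite -[X in X <= _]sum1_card.
    apply: (@leq_trans (\sum_(k in F) #|arcs G c k (C :\: A) O|)).
      rewrite [X in X <= _]big_mkcond [X in _ <= X]big_mkcond /=; apply: leq_sum => k _.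
      by rewrite !inE; case: (k \in F); rewrite ?andbF //= andbT; case: #|arcs G c k (C :\: A) O|.
    by rewrite sum_arcs -sum1_card leq_sum.
  have := cardsID S F; have /setIidPr -> : S \subset F.
    by apply/subsetP => k; rewrite inE => /andP[].
  move: Fcard; clear; lia.
have SF k : k \in S -> k \in F by rewrite inE => /andP[].
have S_arcs k : k \in S -> 1 < #|arcs G c k O A|.
  move=> kS; have kF := SF _ kS; have kFU : k \in F :|: U by rewrite inE kF.
  have := class_le_arcs_out c_proper XOC (state_indep (isT : 0 < 3) st kFU).
  have /subset_leq_card : arcs G c k O C \subset arcs G c k O A.
    apply/subsetP => -[o g]; rewrite !inE /= => /and3P[oO gC og]; rewrite oO og andbT.
    apply/negPn/negP => gA; move: kS; rewrite inE => /andP[_ /eqP/card0_eq/(_ (g, o))].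
    by rewrite !inE /= gA gC oO cadj_sym og.
  have := F_big _ kF; move: XC Mq; clear; lia.
case/card_gt2P: S3 => k1 [k2 [k3 [[k1S k2S k3S] [k12 k23]]]].
rewrite eq_sym => k13.
have [k [k' [o [p [g [h [[kin k'in] kk' op gh [og ph]]]]]]]] :=
  disjoint_arcs k12 k13 k23 (S_arcs _ k1S) (S_arcs _ k2S) (S_arcs _ k3S).
have inS l : l \in [:: k1; k2; k3] -> l \in S.
  by rewrite !in_cons in_nil orbF => /or3P[]/eqP->.
have kF := SF _ (inS _ kin); have k'F := SF _ (inS _ k'in).
move: og ph; rewrite !inE /= => /and3P[oO gA og] /and3P[pO hA ph].
rewrite cadj_sym in og; rewrite cadj_sym in ph.
have gC := subsetP AC _ gA; have hC := subsetP AC _ hA.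
have gM := subsetP CM _ gC; have hM := subsetP CM _ hC.
have [pgg _] := partnerP gM; have [phh _] := partnerP hM.
have pM x : x \in A -> x \in cover M by move/(subsetP AM).
(* If both arcs end on the same edge of [M], that edge can be exchanged for the two directly. *)
case: (eqVneq h (partner g)) => [hE|hpg].
  have fop := fr set0 _ _ (sub0set _) _ oO pO op; rewrite cards0 in fop.
  have := free_no_augment (fop isT) op gC gM _ _ kk' og.
  by rewrite !inE kF k'F -hE ph => /(_ isT isT).
have A2q : #|A| <= 2 * q.
  have := subset_leq_card AM; rewrite card_cover; move: Mq; clear; lia.
have pgA := Apt _ gA; have phA := Apt _ hA.
have [a [b [l1 [l2 [l3 [[aA bA] abE [l1U l2U l3U] [l12 l13 l23] [ga ab bh]]]]]]] :=
  connect AM Apt A2q r7 Adeg pgA phA.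
move: abE; rewrite !edge_partner // !inE !negb_or.
move=> [/andP[ag apg] /andP[ah aph] /andP[bg bpg] /andP[bh' bph] /andP[ba bpa]].
pose Z := [set l1; l2; l3].
have ZU : Z \subset U by rewrite !subUset !sub1set l1U l2U.
have Z3 : #|Z| <= 3.
  by apply: leq_trans (leq_card_setU _ _) _; rewrite cards1 cards2; case: (l1 != l2).
have FZ l l' : l \in F -> l' \in U -> l' != l.
  by move=> lF l'U; apply/eqP => e; have /pred0P/(_ l) := FU; rewrite /= lF -e l'U.
have f0 := fr Z _ _ ZU Z3 oO pO op.
have /andP[go gp] := freeable_neq f0 gC; have /andP[ho hp] := freeable_neq f0 hC.
have /andP[pgo pgp] := freeable_neq f0 (Cpt _ gC).
have hpg' : partner h != g by apply: contra_neq hpg => <-; rewrite partnerK.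
have pgph : partner g != partner h by apply: contra_neq gh; apply: partner_inj.
rewrite eq_sym in pgp; have kFZ : k \in F :|: Z by rewrite inE kF.
(* Switches at [g], [h], [a] and [b] successively free [partner g], [partner h], [partner a] and
   [partner b]. The last edge of the path then joins the uncovered vertices [partner b] and
   [partner h]. *)
have f1 := freeC (free_swap f0 op gC gM og kFZ).
have hC1 : h \in C :\ g :\ partner g by rewrite !inE hpg eq_sym gh.
have k'FZ : k' \in (F :|: Z) :\ k by rewrite !inE k'F eq_sym kk'.
have f2 := freeC (free_swap f1 pgp hC1 hM ph k'FZ).
have aC2 : a \in C :\ g :\ partner g :\ h :\ partner h.
  by rewrite !inE aph ah apg ag (subsetP AC).
have l1FZ : l1 \in (F :|: Z) :\ k :\ k' by rewrite !inE eqxx !orbT !(FZ k, FZ k').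
rewrite cadj_sym in ga; have f3 := free_swap f2 pgph aC2 (pM _ aA) ga l1FZ.
have paph : partner a != partner h.
  by apply: contra_neq ah; apply: partner_inj; rewrite pM.
have bC3 : b \in C :\ g :\ partner g :\ h :\ partner h :\ a :\ partner a.
  by rewrite !inE bpa ba bph bh' bpg bg (subsetP AC).
have l2FZ : l2 \in (F :|: Z) :\ k :\ k' :\ l1.
  by rewrite !inE eqxx !orbT eq_sym l12 !(FZ k, FZ k').
rewrite cadj_sym in ab; have f4 := free_swap f3 paph bC3 (pM _ bA) ab l2FZ.
have := free_nonadj f4 (k := l3); rewrite bh !inE eqxx !orbT.
by rewrite (eq_sym l3 l1) (eq_sym l3 l2) l13 l23 !(FZ k, FZ k') // => /(_ isT).
Qed.

(** The reserve starts at [3 + 2 * J]: two colors for each of up to [J] rounds and three for the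
    final path. In [numeric], [b] stands for the number of deficient vertices. *)
Lemma switching_augments (F : {set K}) a J : [disjoint F & U] ->
  {in F :|: U, forall k, k \notin c @: M} ->
  {in F, forall k, q <= #|color_class G c k|} ->
  #|U| = q + a -> a <= #|F| -> 0 < J ->
  (forall b, b * (a %/ 2).+1 <= 2 * ((3 + 2 * J) * (2 * q) + (q %/ J).+1 * (q + a)) ->
     2 * b + 7 <= a - a %/ 2) ->
  False.
Proof.
move=> FU fresh F_big Ucard Fcard J0 numeric.
(* The choice of [h] just above [q / J] makes [2 * h * J] exceed [2 * q], hence [#|cover M|]. *)
have [|X [O [C [st few]]]] :=
    few_heavy (h := (q %/ J).+1) (state_init (3 + 2 * J) fresh) (leqnn _) FU.
  rewrite card_cover; have := ltn_ceil q J0; move: Mq; clear; nia.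
(* Of the surplus [a] in [#|U|], half may be lost to deficiency; the rest must cover the vertices
   removed with [D] and leave a margin of seven for [connect]. *)
set g := a %/ 2 in numeric; pose D := deficient g C.
have [CM Cpt _ XC _] := st.
have pM x : x \in C -> x \in cover M by move/(subsetP CM).
have Dsmall : 2 * #|D| + 7 <= a - g.
  apply: numeric; apply: leq_trans (deficient_le _ (isT : 0 < 3) st (ltnW few)) _.
  rewrite Ucard leq_mul2l leq_add2r leq_mul2l; apply/orP; right; apply/orP; right.
  move: XC Mq; clear; lia.
pose A := [set v in C | (v \notin D) && (partner v \notin D)].
have inA v : (v \in A) = [&& v \in C, v \notin D & partner v \notin D] by rewrite in_set.
have AC : A \subset C by apply/subsetP => v; rewrite inA => /andP[].
have Apt : {in A, forall v, partner v \in A}.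
  by move=> v; rewrite !inA => /and3P[vC vD pvD]; rewrite Cpt // pvD partnerK ?pM // vD.
have CA : #|C :\: A| <= 2 * #|D|.
  have DC : D \subset C by apply/subsetP => v; rewrite inE => /andP[].
  have /subset_leq_card/leq_trans : C :\: A \subset D :|: partner @: D.
    apply/subsetP => v; rewrite in_setD in_setU inA.
    case/andP=> + vC; rewrite vC /= negb_and !negbK => /orP[->//|pvD].
    by apply/orP; right; apply/imsetP; exists (partner v); rewrite // partnerK ?pM.
  apply; apply: leq_trans (leq_card_setU _ _) _.
  by rewrite mul2n -addnn leq_add2l leq_imset_card.
have Adeg : {in A, forall w, q + (a - g - 2 * #|D|) <= #|nbhd G c U A w|}.
  move=> w; rewrite inA => /and3P[wC]; rewrite in_set wC /= -leqNgt Ucard => wdeg _.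
  have : #|nbhd G c U C w| <= #|nbhd G c U A w| + #|C :\: A|.
    apply: leq_trans (leq_card_setU _ _); apply/subset_leq_card/subsetP => u.
    by rewrite in_setU in_setD !in_set => /andP[uC ->]; rewrite uC !andbT orbN.
  move: CA wdeg Dsmall; clear; lia.
have [X' [O' [C' [F' [st' F'F AC' cards light]]]]] := state_saturate st FU AC Apt.
have r7 : 7 <= a - g - 2 * #|D| by move: Dsmall; clear; lia.
apply: (augment_final st' _ AC' Apt r7 Adeg) => //.
- exact: disjointWl FU.
- by move=> k /(subsetP F'F)/F_big.
- move: cards CA Dsmall Fcard; clear; lia.
Qed.

End Switching.

(** * Extremal matching and choice of parameters *)

Lemma subset_of_card (T : finType) (A : {set T}) n :
  n <= #|A| -> exists2 B : {set T}, B \subset A & #|B| = n.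
Proof.
move=> nA; exists [set x in take n (enum A)].
  by apply/subsetP => x; rewrite inE => /mem_take; rewrite mem_enum.
rewrite cardsE; have /card_uniqP -> := take_uniq n (enum_uniq A).
by rewrite size_takel // -cardE.
Qed.

Lemma max_rainbow_matching (V K : finType) (G : sgraph V) (c : {set V} -> K) :
  exists2 M, rainbow_matching G c M &
    forall N, rainbow_matching G c N -> #|N| <= #|M|.
Proof.
pose P (N : {set {set V}}) := [&& N \subset edges G, trivIset N & dinjectiveb c (mem N)].
have PP (N : {set {set V}}) : reflect (rainbow_matching G c N) (P N).
  apply: (iffP and3P) => [[Ne Nt /dinjectiveP Nr]|[[Ne Nt] Nr]]; first by split.
  by split=> //; apply/dinjectiveP.
have P0 : P set0.
  apply/PP; split; [split; [exact: sub0set|by apply/trivIsetP => A B; rewrite inE]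
                   |by move=> A B; rewrite inE].
case: (arg_maxnP (fun N : {set {set V}} => #|N|) P0) => M /PP Mrm Mmax.
by exists M => // N /PP; apply: Mmax.
Qed.

(** If the conclusion failed, [b] would be about [a / 4] or more, so [8 * b * (a / 2)] would be
    nearly [a * a] at least. The upper bound allows only half of that plus terms linear in [a]. *)
Lemma threshold_arith s a q T b : let J := 192 * s * s in 0 < s ->
  q < s * a.+1 -> (128 * T + 96) * s + 53 <= a ->
  b * (a %/ 2).+1 <= 2 * (T * (2 * q) + (q %/ J).+1 * (q + a)) ->
  2 * b + 7 <= a - a %/ 2.
Proof.
move=> J s0 qa a_big bound; rewrite leqNgt; apply/negP => b_big.
have: q %/ J * J <= q by apply: leq_trunc_div.
rewrite /J; move: (q %/ _) bound => h bound hJ {J}.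
have ab : a <= 4 * b + 13 by move: b_big; clear; lia.
have [y [ay ya yb]] : exists y, [/\ a <= 2 * y, y <= a &
    b * y <= 2 * (T * (2 * q) + h.+1 * (q + a))].
  exists (a %/ 2).+1; split=> //; move: a_big; clear; lia.
clear bound b_big.
have q2 : q <= 2 * (s * a).
  have : s <= s * a by rewrite leq_pmulr //; move: a_big; clear; lia.
  by move: qa; rewrite mulnS; clear; lia.
have a_sa : a <= s * a by rewrite leq_pmull.
have h_le : 96 * (s * h) <= a.
  rewrite -(leq_pmul2l (m := 2 * s)); last by rewrite muln_gt0.
  have -> : 2 * s * (96 * (s * h)) = h * (192 * s * s) by ring.
  by apply: leq_trans hJ _; rewrite -mulnA.
(* The factor 192 in [J] is chosen for this: after multiplication by 16, the heavy term takes at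
   most half of [a * a]. *)
have hq : 32 * (h * (q + a)) <= a * a.
  rewrite -(leq_pmul2l (m := 3 * s)); last by rewrite muln_gt0.
  have -> : 3 * s * (32 * (h * (q + a))) = (96 * (s * h)) * (q + a) by ring.
  have -> : 3 * s * (a * a) = a * (3 * (s * a)) by ring.
  by apply: leq_mul => //; move: q2 a_sa; clear; lia.
have lower : a * a <= 8 * (b * y) + 26 * a.
  have : a * a <= (4 * b + 13) * (2 * y) by apply: leq_mul.
  have -> : (4 * b + 13) * (2 * y) = 8 * (b * y) + 26 * y by ring.
  by move: ya; clear; lia.
have Tq : T * (2 * q) <= T * (4 * (s * a)).
  by rewrite leq_mul2l; apply/orP; right; move: q2; clear; lia.
have upper : a * a <= a * ((128 * T + 96) * s + 52).
  have -> : a * ((128 * T + 96) * s + 52) =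
    32 * (T * (4 * (s * a))) + 96 * (s * a) + 52 * a by ring.
  move: yb; rewrite (mulSn h); move: (s * a) (T * (4 * (s * a))) (b * y) (h * (q + a)) (T * (2 * q))
    (a * a) Tq hq lower q2 a_sa; clear; lia.
move: upper; rewrite leq_mul2l; case/orP => [/eqP|]; move: a_big; clear; lia.
Qed.

Lemma rainbow_matching_of_many_colors s : 0 < s ->
  exists N, forall q, N <= q ->
    forall (V K : finType) (G : sgraph V) (c : {set V} -> K),
      proper_edge_coloring G c ->
      2 * q + 2 * (q %/ s) <= #|colors G c| ->
      {in colors G c, forall k, q <= #|color_class G c k|} ->
      exists M, rainbow_matching G c M /\ #|M| = q.
Proof.
move=> s0; pose J := 192 * s * s; pose T := 3 + 2 * J.
(* This makes [q %/ s] reach the lower bound on [a] in [threshold_arith]. *)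
exists (s * ((128 * T + 96) * s + 53)) => q Nq V K G c c_proper many big.
have [M Mrm Mmax] := max_rainbow_matching G c.
case: (leqP q #|M|) => [/subset_of_card[B BM Bq]|Mq].
  by exists B; split=> //; apply: rm_sub Mrm.
exfalso; set a := q %/ s in many.
pose fresh := colors G c :\: c @: M.
have fresh_card : q + 2 * a <= #|fresh|.
  have := cardsID (c @: M) (colors G c); rewrite -/fresh.
  have := subset_leq_card (subsetIr (colors G c) (c @: M)).
  have := leq_imset_card c M; move: many Mq.
  move: #|colors G c| #|M| #|fresh| #|c @: M| #|colors G c :&: _|; lia.
have [|U Ufresh Ucard] := @subset_of_card _ fresh (q + a).
  by apply: leq_trans fresh_card; rewrite leq_add2l leq_pmull.
pose F := fresh :\: U.
have FU : [disjoint F & U] by apply/pred0P => k /=; rewrite inE; case: (k \in U); rewrite ?andbF.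
have freshP k : k \in F :|: U -> k \in colors G c /\ k \notin c @: M.
  have : F :|: U \subset fresh by rewrite subUset subsetDl.
  by move=> /subsetP sub /sub; rewrite inE => /andP[].
apply: (switching_augments c_proper Mrm Mmax Mq (U := U) _ (F := F) (a := a) (J := J)).
- by move=> k kU; apply: big; case: (freshP k); rewrite // inE kU orbT.
- exact: FU.
- by move=> k /freshP[].
- by move=> k kF; apply: big; case: (freshP k); rewrite // inE kF.
- exact: Ucard.
- have := cardsID U fresh; have /setIidPr -> := Ufresh; rewrite -/F.
  move: fresh_card Ucard; clear; lia.
- by rewrite !muln_gt0 s0.
move=> b; apply: threshold_arith => //; first by rewrite mulnC; apply: ltn_ceil.
by rewrite leq_divRL // mulnC.
Qed.

(** * From integer parameters to a real [eps] *)

Import Order.TTheory GRing.Theory Num.Theory.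

Local Open Scope ring_scope.

Theorem theorem1p11 (R : realType) (eps : R) (heps : 0 < eps) :
  exists N : nat, forall q : nat, (N <= q)%N ->
    forall (V C : finType) (G : sgraph V) (c : {set V} -> C),
      proper_edge_coloring G c ->
      2 * (1 + eps) * q%:R <= #|colors G c|%:R :> R ->
      (forall k : C, k \in colors G c -> (q <= #|color_class G c k|)%N) ->
      exists M : {set {set V}}, rainbow_matching G c M /\ #|M| = q.
Proof.
(* The integer [s] bounds the inverse of [eps], so [2 * eps * q] is at least [2 * (q %/ s)]. *)
have [s s0 eps_s] : exists2 s : nat, (0 < s)%N & 1 <= eps * s%:R.
  have einv : 0 < eps^-1 by rewrite invr_gt0.
  have bound := archi_boundP (ltW einv); exists (Num.bound eps^-1).
    by rewrite -(ltr_nat R); apply: lt_trans bound.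
  by rewrite -ler_pdivrMl // mulr1 ltW.
have [N HN] := rainbow_matching_of_many_colors s0.
exists N => q Nq V C G c c_proper many big; apply: (HN q) => //.
rewrite -(ler_nat R); apply: le_trans many.
rewrite natrD !natrM mulrDr mulrDl mulr1 lerD2l -mulrA ler_pM2l //.
apply: (@le_trans _ _ (eps * s%:R * (q %/ s)%:R)).
  by rewrite ler_peMl.
by rewrite -mulrA -natrM ler_pM2l // ler_nat mulnC leq_trunc_div.
Qed.
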